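(* Let $p(x)=\sum_{r_1+\dots+r_m=n}a_{r}\prod_i x_i^{r_i}$ and $q(x)=\sum_{r_1+\dots+r_m=n}b_{r}\prod_i x_i^{r_i}$ be H-Stable homogeneous polynomials of degree $n$ in $m$ variables with nonnegative coefficients, and let $(l_1,\dots,l_m)$ be a nonnegative real vector with $\sum_i l_i=n$. Suppose $$A:=\inf_{x_i>0}\frac{p(x_1,\dots,x_m)}{\prod_i x_i^{l_i}}>0,\qquad B:=\inf_{x_i>0}\frac{q(x_1,\dots,x_m)}{\prod_i x_i^{l_i}}>0.$$ Then $$\sum_{r_1+\dots+r_m=n}a_{r}b_{r}\ge AB\,\frac{\mathrm{vdw}(nm)}{\mathrm{vdw}(n)^m}.$$
   Context: A homogeneous polynomial $p$ in $m$ variables is H-Stable if $p(z)\ne0$ whenever $\mathrm{Re}(z_i)>0$ for all $i$. $\mathrm{vdw}(r)=r!/r^r$. *)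

(* Defs.v *)
From mathcomp Require Import all_boot all_order all_algebra complex mpoly.
From mathcomp Require Import classical_sets reals exp.

Set Implicit Arguments.
Unset Strict Implicit.
Unset Printing Implicit Defensive.

Import Order.TTheory GRing.Theory Num.Theory.

Local Open Scope classical_set_scope.
Local Open Scope ring_scope.

(* Homogeneity is not part of this predicate; it is a separate hypothesis
   wherever HStable is used. *)
Definition HStable (R : realType) (m : nat) (p : {mpoly R[m]}) : Prop :=
  forall z : 'I_m -> complex R, (forall i, 0 < complex.Re (z i)) ->
    (map_mpoly (real_complex R) p).@[z] != 0.

(* r! / r^r, with vdw 0 = 1 since 0 ^+ 0 = 1. *)
Definition vdw (R : realType) (r : nat) : R := r`!%:R / r%:R ^+ r.

(* The infimum is taken in R (not in the extended reals); it is the true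
   infimum when p has nonnegative coefficients, as the quotients are then
   bounded below by 0. *)
Definition capacity (R : realType) (m : nat) (l : 'I_m -> R)
    (p : {mpoly R[m]}) : R :=
  inf [set p.@[x] / \prod_(i < m) (x i `^ l i)
      | x in [set x : 'I_m -> R | forall i, 0 < x i]].

(* Main.v *)
Require Import Defs.
From mathcomp Require Import all_boot all_order all_algebra complex mpoly.
From mathcomp Require Import classical_sets reals exp.
From mathcomp Require Import ring lra.

Set Implicit Arguments.
Unset Strict Implicit.
Unset Printing Implicit Defensive.

Import Order.TTheory GRing.Theory Num.Theory.

Local Open Scope ring_scope.

(** The sum of the a_r b_r is the coefficient of x_1^n ... x_m^n in
    F(x) = p(x) * (x_1 ... x_m)^n q(1/x_1, ..., 1/x_m), an H-stable homogeneous
    polynomial of degree nm with F(x) >= A B x_1^n ... x_m^n on positive x.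
    The variables of F are eliminated one at a time, keeping the coefficient of
    t^n in the last variable t. Two facts make this work. First, for positive x
    the polynomial t -> F(x, t) has only negative real roots, so Newton's
    inequalities bound it by a multiple of a binomial power (1 + s t)^k having
    the same coefficient of t^n; evaluating at the minimiser of (1 + s t)^k / t^n
    gives a loss factor vdw(k) / (vdw(n) vdw(k - n)) at degree k, and these
    factors telescope. Second, the coefficient of t^n is again stable, by
    Gauss-Lucas. The latter needs full degree and no root at 0; this is
    guaranteed by first replacing x_i with x_i + e (x_1 + ... + x_m), and e is
    sent to 0 at the end. *)

(** * Newton's inequalities and the univariate bound *)

Section Univariate.
Variable R : realFieldType.
Implicit Types (c : nat -> R) (s : seq R).

(** The inductive step of Newton's inequalities under multiplication by [X + a]: the right side
    minus the left is a square plus nonnegative multiples of the gaps in the three hypotheses on the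
    [c]'s. *)
Lemma newton_step (u v a c0 c1 c2 c3 : R) : 1 <= u -> 1 <= v ->
  c0 * c2 <= c1 ^+ 2 -> c1 * c3 <= c2 ^+ 2 -> c0 * c3 <= c1 * c2 ->
  0 <= a ->
  ((u + 1) * a * c1 + (v - 1) * c0) * ((u - 1) * a * c3 + (v + 1) * c2)
    <= (u * a * c2 + v * c1) ^+ 2.
Proof.
move=> u1 v1 h1 h2 h3 a0; rewrite -subr_ge0.
have -> : (u * a * c2 + v * c1) ^+ 2 -
  ((u + 1) * a * c1 + (v - 1) * c0) * ((u - 1) * a * c3 + (v + 1) * c2) =
  (a * c2 - c1) ^+ 2 + (u - 1) * (u + 1) * a ^+ 2 * (c2 ^+ 2 - c1 * c3)
  + (v - 1) * (v + 1) * (c1 ^+ 2 - c0 * c2)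
  + (u - 1) * (v - 1) * a * (c1 * c2 - c0 * c3) by ring.
have um : 0 <= u - 1 by lra.
have up : 0 <= u + 1 by lra.
have vm : 0 <= v - 1 by lra.
have vp : 0 <= v + 1 by lra.
by rewrite !addr_ge0 ?sqr_ge0 // !mulr_ge0 ?sqr_ge0 ?subr_ge0.
Qed.

Lemma prod_linear_cons (w : R) s i :
  (\prod_(x <- w :: s) ('X + x%:P))`_i =
  w * (\prod_(x <- s) ('X + x%:P))`_i
  + (if i is j.+1 then (\prod_(x <- s) ('X + x%:P))`_j else 0).
Proof.
rewrite big_cons mulrDl coefD coefXM mul_polyC coefZ addrC.
by case: i.
Qed.

(** Meant for the coefficients of a polynomial of degree [k] divided by binomials. Strict positivity
    up to [k] rules out internal zeros, so ratios of consecutive terms decrease. *)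
Definition log_concave c (k : nat) := [/\ forall i, (i <= k)%N -> 0 < c i,
  forall i, (k < i)%N -> c i = 0 & forall i, c i * c i.+2 <= c i.+1 ^+ 2].

Lemma log_concave_ge0 c k i : log_concave c k -> 0 <= c i.
Proof.
by case=> cp c0 _; case: (leqP i k) => [/cp/ltW|/c0->].
Qed.

Lemma log_concave_ratio c k i d : log_concave c k ->
  c i * c (i + d).+1 <= c i.+1 * c (i + d)%N.
Proof.
move=> lc; have [cp c0 cc] := lc; have cge j := log_concave_ge0 j lc.
elim: d => [|d IH]; first by rewrite addn0 mulrC.
rewrite addnS; case: (ltnP k (i + d).+1) => hk.
  by rewrite (c0 (i + d).+2) ?mulr0 ?mulr_ge0 // ltnW.
have p1 := cp _ hk; have p0 := cp _ (ltnW hk).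
rewrite -(ler_pM2r p0) -mulrA [_ * c (i + d)%N]mulrC.
apply: le_trans (ler_wpM2l (cge i) (cc (i + d)%N)) _.
rewrite expr2 mulrA [leRHS]mulrAC.
by apply: ler_wpM2r => //; exact: ltW.
Qed.

(** Induction on the factors: a new [X + w] mixes neighbouring normalised coefficients with Pascal
    weights, and [newton_step] keeps the mixture log-concave. *)
Lemma newton s : all (> 0) s -> exists2 c, log_concave c (size s) &
  forall i, (\prod_(x <- s) ('X + x%:P))`_i = c i *+ 'C(size s, i).
Proof.
elim: s => [|w s IH] /=.
  move=> _; exists (fun i => (i == 0%N)%:R) => [|i].
    split=> [[]|[]|i] //=; rewrite ?mulr0 ?expr0n //=.
  by rewrite big_nil coef1 bin0n; case: i.
case/andP=> w0 /IH[c lc ce] {IH}; set k := size s in lc ce *.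
have [cp c0 cc] := lc; have cge j := log_concave_ge0 j lc.
have k1 : 0 < k.+1%:R :> R by rewrite ltr0n.
(* For [i > 0] the weights are ['C(k, i) / 'C(k.+1, i)] and ['C(k, i.-1) / 'C(k.+1, i)]; at [i = 0]
   the default [c 0] for the missing neighbour has weight 0. *)
pose d i := ((k.+1 - i)%:R * w * c i + i%:R * c i.-1) / k.+1%:R.
exists d; first split.
- move=> i; rewrite leq_eqVlt => /predU1P[->|ik].
    by rewrite /d subnn !mul0r add0r /= mulr_gt0 ?invr_gt0 // mulr_gt0 ?cp.
  rewrite divr_gt0 // ltr_pwDl ?mulr_ge0 ?cge ?ler0n //.
  by rewrite !mulr_gt0 ?cp // ltr0n subn_gt0.
- move=> i ik; rewrite /d (c0 i (ltnW ik)) (c0 i.-1) ?mulr0 ?addr0 ?mul0r //.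
  by case: i ik.
- move=> i; rewrite /d /=; case: (ltnP k i.+1) => ik.
    rewrite (c0 i.+1) // (c0 i.+2) 1?ltnW // !mulr0 add0r mul0r mulr0.
    exact: sqr_ge0.
  rewrite expr_div_n mulf_div -expr2.
  apply: ler_wpM2r; first by rewrite invr_ge0 exprn_ge0 ?ler0n.
  have E1 : (k.+1 - i)%:R = (k.+1 - i.+1)%:R + 1 :> R.
    by rewrite natr1 subnSK // ltnW.
  have E2 : (k.+1 - i.+2)%:R = (k.+1 - i.+1)%:R - 1 :> R.
    by rewrite -(@subnSK i.+1 k.+1) // -natr1 addrK.
  have E3 : i%:R = i.+1%:R - 1 :> R by rewrite -natr1 addrK.
  have E4 : i.+2%:R = i.+1%:R + 1 :> R by rewrite natr1.
  have E5 : (i%:R : R) * c i.-1 = i%:R * (if i is j.+1 then c j else 0).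
    by case: i {ik E1 E2 E3 E4} => //=; rewrite !mul0r.
  rewrite E5 E1 E2 E3 E4; apply: newton_step; rewrite ?ler1n ?subn_gt0 //=.
  + by case: i {ik E1 E2 E3 E4 E5} => [|i]; rewrite ?mul0r ?sqr_ge0 ?cc.
  + case: i {ik E1 E2 E3 E4 E5} => [|i]; first by rewrite mul0r mulr_ge0.
    by have := log_concave_ratio i 2 lc; rewrite addn2.
  + exact: ltW.
- move=> i; rewrite prod_linear_cons !ce /d.
  have kn : k.+1%:R != 0 :> R by rewrite gt_eqF.
  case: i => [|i].
    rewrite subn0 mul0r addr0 !bin0 !mulr1n addr0; by field; rewrite addrC natr1.
  rewrite ce /=; set X := _ / _; rewrite -(mulr_natr (c i.+1)) -(mulr_natr (c i)).
  rewrite -(mulr_natr X); apply: (mulfI kn).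
  have -> : k.+1%:R * (X * 'C(k.+1, i.+1)%:R) = 'C(k.+1, i.+1)%:R *
     ((k.+1 - i.+1)%:R * w * c i.+1 + i.+1%:R * c i).
    by rewrite mulrA [k.+1%:R * X]mulrC divfK // mulrC.
  have B1 : k.+1%:R * 'C(k, i)%:R = i.+1%:R * 'C(k.+1, i.+1)%:R :> R.
    by rewrite -!natrM mul_bin_diag.
  have B2 : k.+1%:R * 'C(k, i.+1)%:R = (k.+1 - i.+1)%:R * 'C(k.+1, i.+1)%:R :> R.
    by rewrite -!natrM mul_bin_down.
  rewrite mulrDr mulrDr; congr (_ + _).
    rewrite [w * _]mulrA mulrCA B2; ring.
  rewrite mulrCA B1; ring.
Qed.

(** Decreasing ratios on either side of [n] keep [c] below the geometric sequence through its terms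
    [n] and [n.+1]; multiplying out avoids negative exponents. *)
Lemma log_concave_envelope c k n i : log_concave c k -> (n < k)%N -> (i <= k)%N ->
  c i * (c n.+1 / c n) ^+ n <= c n * (c n.+1 / c n) ^+ i.
Proof.
move=> lc nk ik; have [cp _ _] := lc; set r := _ / _.
have cn0 := cp _ (ltnW nk); have cn1 := cp _ nk.
have r0 : 0 < r by rewrite divr_gt0.
have cge j := log_concave_ge0 j lc.
have up d : c (n + d)%N <= c n * r ^+ d.
  elim: d => [|d IH]; first by rewrite addn0 mulr1.
  rewrite addnS exprSr mulrA; apply: le_trans (ler_wpM2r (ltW r0) IH).
  rewrite /r mulrA ler_pdivlMr // mulrC [leRHS]mulrC.
  exact: log_concave_ratio lc.
have down d : (d <= n)%N -> c (n - d)%N * r ^+ d <= c n.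
  elim: d => [|d IH] dn; first by rewrite subn0 mulr1.
  apply: le_trans (IH (ltnW dn)); rewrite exprS mulrA.
  apply: ler_wpM2r; first by rewrite exprn_ge0 ?ltW.
  rewrite /r mulrA ler_pdivrMr //.
  have := log_concave_ratio (n - d.+1) d.+1 lc.
  by rewrite subnK // subnSK.
have [le|lt] := leqP n i.
  have /(ler_wpM2r (exprn_ge0 n (ltW r0))) := up (i - n)%N.
  by rewrite subnKC // -mulrA -exprD subnK.
have /(ler_wpM2r (exprn_ge0 i (ltW r0))) := down _ (leq_subr i n).
by rewrite subKn 1?ltnW // -mulrA -exprD subnK 1?ltnW.
Qed.

(** With [r] the ratio [c n.+1 / c n], the envelope bounds the product by [c n / r ^ n] times
    [(1 + r t) ^ k], which has the same coefficient at [n]; one well-chosen [t] then gives the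
    constant. *)
Lemma prod_linear_coef_ge s (n : nat) (C : R) : (0 < n < size s)%N ->
  all (> 0) s ->
  (forall t, 0 < t -> C * t ^+ n <= (\prod_(x <- s) ('X + x%:P)).[t]) ->
  C * (n%:R ^+ n * (size s - n)%:R ^+ (size s - n) / (size s)%:R ^+ size s)
    *+ 'C(size s, n) <= (\prod_(x <- s) ('X + x%:P))`_n.
Proof.
move=> /andP[n0 nk] /newton[c lc ce]; rewrite ce.
set k := size s in nk lc ce *; set f := \prod_(x <- s) _ in ce *.
move=> Cf; rewrite lerMn2r; apply/orP; right.
have [cp c0 _] := lc.
have cn0 := cp _ (ltnW nk); have cn1 := cp _ nk.
pose r := c n.+1 / c n; have r0 : 0 < r by rewrite divr_gt0.
have szf : (size f <= k.+1)%N.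
  apply/leq_sizeP => j kj; rewrite ce (c0 j) ?mul0rn //.
have n0R : 0 < n%:R :> R by rewrite ltr0n.
have kn0R : 0 < (k - n)%:R :> R by rewrite ltr0n subn_gt0.
(* This [y] minimises [(1 + y) ^ k / y ^ n]; the minimum is the reciprocal of the constant in the
   statement, binomial apart. *)
pose y : R := n%:R / (k - n)%:R; have y0 : 0 < y by rewrite divr_gt0.
have t0 : 0 < y / r by rewrite divr_gt0.
have env : f.[y / r] * r ^+ n <= c n * (1 + y) ^+ k.
  rewrite (horner_coef_wide _ szf) mulr_suml exprDn mulr_sumr.
  apply: ler_sum => i _; rewrite expr1n mul1r ce mulrnAl mulrnAl mulrnAr.
  rewrite ler_wMn2r // expr_div_n.
  have ri : 0 < r ^+ i by rewrite exprn_gt0.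
  rewrite mulrA mulrAC ler_pdivrMr // mulrAC [leRHS]mulrAC.
  apply: ler_wpM2r; first by rewrite exprn_ge0 ?ltW.
  by apply: log_concave_envelope lc nk _; rewrite -ltnS.
have {env} : C * y ^+ n <= c n * (1 + y) ^+ k.
  apply: le_trans env; have := ler_wpM2r (exprn_ge0 n (ltW r0)) (Cf _ t0).
  by rewrite expr_div_n mulrA divfK // expf_neq0 ?gt_eqF.
have -> : 1 + y = k%:R / (k - n)%:R.
  rewrite /y -[X in X + _](divff (lt0r_neq0 kn0R)) -mulrDl -natrD subnK //.
  exact: ltnW.
have k0R : 0 < k%:R :> R by rewrite ltr0n (leq_trans _ nk).
rewrite !expr_div_n [c n * _]mulrA ler_pdivlMr ?exprn_gt0 //.
move=> H; rewrite mulrA ler_pdivrMr ?exprn_gt0 //; apply: le_trans H.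
rewrite -[in leRHS](subnKC (ltnW nk)) [in X in _ <= _ * X]addnC exprD.
rewrite addnC addnK.
have kn : (k - n)%:R != 0 :> R by rewrite gt_eqF.
by rewrite -[leRHS]mulrA -!mulrA [_^-1 * _]mulrCA mulVf ?mulr1 ?expf_neq0.
Qed.

End Univariate.

(** * Polynomials without zeros in a half-plane *)

Section HalfPlane.
Variable R : rcfType.
Local Notation Re := complex.Re.
Local Notation RC := (real_complex R).

Lemma complex_ReD (z w : R[i]) : Re (z + w) = Re z + Re w.
Proof. by case: z w => [a b] [c d]. Qed.

Lemma complex_ReB (z w : R[i]) : Re (z - w) = Re z - Re w.
Proof. by case: z w => [a b] [c d]. Qed.

Lemma complex_ReV_gt0 (z : R[i]) : 0 < Re z -> 0 < Re z^-1.
Proof.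
case: z => a b /= a0; rewrite divr_gt0 // ltr_wpDr ?sqr_ge0 //.
by rewrite exprn_gt0.
Qed.

(* Gauss-Lucas through the logarithmic derivative: u = sum of 1/(z - w). *)
Lemma deriv_prod_XsubC_half_plane (s : seq R[i]) (z : R[i]) :
  (forall w, w \in s -> Re w < Re z) -> s != [::] ->
  exists2 u, 0 < Re u & (\prod_(w <- s) ('X - w%:P))^`().[z]
                        = u * (\prod_(w <- s) ('X - w%:P)).[z].
Proof.
elim: s => // w s IH hs _.
have zw : 0 < Re (z - w) by rewrite complex_ReB subr_gt0 hs ?mem_head.
have zw0 : z - w != 0 by apply: contraTneq zw => ->; rewrite ltxx.
have := complex_ReV_gt0 zw; set v := _^-1 => v0.
have vK : v * (z - w) = 1 by rewrite mulVf.
have [->|sn0] := eqVneq s [::].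
  exists v => //; rewrite big_seq1 derivXsubC !hornerE vK //.
have [|u u0 Hu] := IH _ sn0.
  by move=> x xs; apply: hs; rewrite inE xs orbT.
exists (v + u); first by rewrite complex_ReD addr_gt0.
rewrite big_cons derivM derivXsubC mul1r hornerD !hornerM hornerXsubC Hu.
set P := (\prod_(j <- s) _).[z].
transitivity (v * (z - w) * P + u * (z - w) * P); last by ring.
by rewrite vK; ring.
Qed.

(** All roots lie strictly to the left of [z], so the logarithmic derivative at [z] has positive
    real part. *)
Lemma deriv_neq0_half_plane (f : {poly R[i]}) : (1 < size f)%N ->
  (forall z, 0 <= Re z -> f.[z] != 0) -> forall z, 0 <= Re z -> f^`().[z] != 0.
Proof.
move=> sf fn z z0; have [s fE] := closed_field_poly_normal f.
have lf : lead_coef f != 0.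
  by rewrite lead_coef_eq0 -size_poly_eq0 -lt0n (ltn_trans _ sf).
have sn0 : s != [::].
  apply: contraTneq sf => s0; rewrite fE s0 big_nil alg_polyC.
  by rewrite -leqNgt size_polyC_leq1.
have [|u u0 Hu] := @deriv_prod_XsubC_half_plane s z _ sn0.
  move=> w ws; apply: lt_le_trans z0; rewrite ltNge; apply/negP => /fn.
  by rewrite fE hornerZ mulf_eq0 negb_or -/(root _ _) root_prod_XsubC ws andbF.
have -> : f^`().[z] = u * f.[z].
  by rewrite {1 2}fE derivZ !hornerZ Hu mulrCA.
rewrite mulf_neq0 ?fn //; apply: contraTneq u0 => ->; by rewrite ltxx.
Qed.

(** Up to a nonzero factor this coefficient is the [n]-th derivative at 0, and each derivative
    inherits the zero-free closed half-plane. *)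
Lemma coef_neq0_half_plane (n : nat) (f : {poly R[i]}) :
  (forall z, 0 <= Re z -> f.[z] != 0) -> (n < size f)%N -> f`_n != 0.
Proof.
elim: n f => [|n IH] f fn sf; first by rewrite -horner_coef0 fn.
have sf1 : (1 < size f)%N by apply: leq_trans sf.
have := @IH f^`() (deriv_neq0_half_plane sf1 fn).
rewrite coef_deriv mulrn_eq0 /=; apply.
case E : (size f) sf sf1 => [|[|k]] // kn _.
have : f^`()`_k != 0.
  rewrite coef_deriv mulrn_eq0 /=; have -> : f`_k.+1 = lead_coef f.
    by rewrite lead_coefE E.
  by rewrite lead_coef_eq0 -size_poly_eq0 E.
apply: contraNltn => /leq_trans h; apply/eqP; apply: nth_default; exact: h.
Qed.

(** The splitting over [R[i]] has only real roots, so it descends to [R] by injectivity of the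
    embedding; [s] lists the negated roots. *)
Lemma negative_roots_factor (f : {poly R}) : f != 0 ->
  (forall z, root (map_poly RC f) z -> (complex.Im z == 0) && (Re z < 0)) ->
  exists2 s, all (> 0) s & f = lead_coef f *: \prod_(w <- s) ('X + w%:P).
Proof.
move=> f0 fr; have [s fE] := closed_field_poly_normal (map_poly RC f).
have lf : lead_coef (map_poly RC f) = RC (lead_coef f) by rewrite lead_coef_map.
have sr z : z \in s -> (complex.Im z == 0) && (Re z < 0).
  move=> zs; apply: fr; rewrite fE rootZ ?root_prod_XsubC // lf fmorph_eq0.
  by rewrite lead_coef_eq0.
exists [seq - Re z | z <- s].
  by apply/allP => _ /mapP[z /sr /andP[_ zn] ->]; rewrite oppr_gt0.
apply: (map_poly_inj RC); rewrite {1}fE map_polyZ lf; congr (_ *: _).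
rewrite rmorph_prod big_map; apply: eq_big_seq => z /sr /andP[/eqP zi _] /=.
rewrite rmorphD /= map_polyX map_polyC /=; congr (_ + _).
rewrite rmorphN polyCN; congr (- _%:P); case: z zi => a b /= -> //.
Qed.

End HalfPlane.

(** * Slicing along the last variable *)

Section Slice.
Variables (R : comNzRingType) (m : nat).
Implicit Types F : {mpoly R[m.+1]}.
Local Notation widen := (widen_ord (leqnSn m)).

Lemma mmap_dhomog (S : comNzRingType) (k d : nat) (f : {rmorphism R -> S})
    (a : S) (z : 'I_k -> S) (F : {mpoly R[k]}) :
  F \is d.-homog -> mmap f (fun i => a * z i) F = a ^+ d * mmap f z F.
Proof.
move=> /dhomogP Fd; rewrite /mmap mulr_sumr; apply: eq_big_seq => r rF.
have rd : mdeg r = d := Fd _ rF.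
rewrite mulrCA; congr (_ * _); rewrite /mmap1 -rd mdegE -prodrXr -big_split.
by apply: eq_bigr => i _; rewrite exprMn.
Qed.

Lemma mmap_muni (S : comNzRingType) (f : {rmorphism R -> S}) (z : 'I_m.+1 -> S) F :
  mmap f z F = (map_poly (mmap f (fun i => z (widen i))) (muni F)).[z ord_max].
Proof.
rewrite muniE raddf_sum horner_sum [LHS]/mmap; apply: eq_bigr => r _ /=.
rewrite map_polyZ hornerZ map_polyXn hornerXn /= mmapZ mmapX -mulrA.
congr (_ * _); rewrite /mmap1 big_ord_recr; congr (_ * _).
by apply: eq_bigr => i _; rewrite mnmE.
Qed.

Lemma coef_muni j F : (muni F)`_j =
  \sum_(r <- msupp F | r ord_max == j)
    F@_r *: 'X_[[multinom (r (widen i)) | i < m]].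
Proof.
rewrite muniE coef_sum [RHS]big_mkcond; apply: eq_bigr => r _.
rewrite coefZ coefXn eq_sym; case: eqP => _; by rewrite ?mulr1 ?mulr0.
Qed.

Lemma dhomog_coef_muni j d F : F \is d.-homog -> (muni F)`_j \is (d - j).-homog.
Proof.
move=> /dhomogP Fd; rewrite coef_muni big_seq_cond; apply: rpred_sum.
move=> r /andP[rF /eqP rj]; have rd : mdeg r = d := Fd _ rF.
apply: dhomogZ; rewrite dhomogX.
rewrite -rd -rj !mdegE big_ord_recr addnK; apply/eqP.
rewrite [LHS]mdegE; apply: eq_bigr => i _.
by rewrite mnmE.
Qed.

Lemma coef_muni_gt j d F : F \is d.-homog -> (d < j)%N -> (muni F)`_j = 0.
Proof.
move=> /dhomogP Fd dj; rewrite coef_muni big_seq_cond big1 // => r.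
case/andP=> rF /eqP rj; have rd : mdeg r = d := Fd _ rF.
move: dj; rewrite -rd -rj mdegE big_ord_recr /=.
by rewrite ltnNge leq_addl.
Qed.

Lemma mcoeff_muni_const n F :
  ((muni F)`_n)@_[multinom n | i < m] = F@_[multinom n | i < m.+1].
Proof.
rewrite coef_muni raddf_sum /= [in RHS](mpolyE F) raddf_sum [LHS]big_mkcond /=.
apply: eq_bigr => r _; rewrite !mcoeffZ !mcoeffX.
case: (r ord_max =P n) => rn.
  congr (_ * _%:R); congr nat_of_bool; apply/eqP/eqP => [h|->].
    apply/mnmP => i; rewrite mnmE; case: (unliftP ord_max i) => [j|] -> //.
    have -> : lift ord_max j = widen j
      by apply: val_inj; rewrite /= /bump leqNgt ltn_ord.
    by move/mnmP: h => /(_ j); rewrite !mnmE.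
  by apply/mnmP => i; rewrite !mnmE.
case: eqP => [rE|]; last by rewrite mulr0.
by case: rn; rewrite rE mnmE.
Qed.

End Slice.

Section Extend.
Variables (T : Type) (m : nat).
Definition extend (z : 'I_m -> T) (t : T) (i : 'I_m.+1) : T :=
  if unlift ord_max i is Some j then z j else t.

Lemma extend_max z t : extend z t ord_max = t.
Proof. by rewrite /extend unlift_none. Qed.

Lemma extend_widen z t i : extend z t (widen_ord (leqnSn m) i) = z i.
Proof.
have -> : widen_ord (leqnSn m) i = lift ord_max i.
  by apply: val_inj; rewrite /= /bump leqNgt ltn_ord.
by rewrite /extend liftK.
Qed.

Lemma extend_all (P : T -> Prop) z t :
  (forall i, P (z i)) -> P t -> forall i, P (extend z t i).
Proof. by move=> Pz Pt i; rewrite /extend; case: unlift. Qed.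
End Extend.

Lemma mmap_ext (R S : nzRingType) (k : nat) (f : R -> S) (h h' : 'I_k -> S)
  (F : {mpoly R[k]}) : h =1 h' -> mmap f h F = mmap f h' F.
Proof. by move=> hh; apply: eq_bigr => r _; congr (_ * _); apply: mmap1_eq. Qed.

Lemma horner_muni (R S : comNzRingType) (m : nat) (f : {rmorphism R -> S})
    (F : {mpoly R[m.+1]}) (z : 'I_m -> S) t :
  (map_poly (mmap f z) (muni F)).[t] = mmap f (extend z t) F.
Proof.
rewrite mmap_muni extend_max; congr (_.[_]); apply: eq_map_poly => P.
by apply: mmap_ext => i; rewrite extend_widen.
Qed.

(** * Coefficients of strongly stable polynomials *)

Section Stable.
Variable R : realType.
Local Notation Re := complex.Re.
Local Notation RC := (real_complex R).

(** Coordinates on the imaginary axis are allowed as long as one is strictly to the right. This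
    supplies the full degree and the nonvanishing at 0 that Gauss-Lucas requires. *)
Definition strongly_stable (m : nat) (F : {mpoly R[m]}) : Prop :=
  forall z : 'I_m -> R[i], (forall i, 0 <= Re (z i)) ->
    (exists i, 0 < Re (z i)) -> mmap RC z F != 0.

Lemma mmap_real m (x : 'I_m -> R) (F : {mpoly R[m]}) :
  mmap RC (fun i => RC (x i)) F = RC F.@[x].
Proof.
rewrite mevalE rmorph_sum; apply: eq_bigr => r _.
rewrite rmorphM rmorph_prod; congr (_ * _).
by apply: eq_bigr => i _; rewrite rmorphXn.
Qed.

(** At the point [(0, ..., 0, 1)] only the top coefficient in the last variable survives, and it is
    a constant by homogeneity. *)
Lemma strongly_stable_lead m d (F : {mpoly R[m.+1]}) (z : 'I_m -> R[i]) :
  strongly_stable F -> F \is d.-homog -> mmap RC z (muni F)`_d != 0.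
Proof.
(* Zero is written [0 * z i] so that [mmap_dhomog] scales each coefficient by a power of 0, which is
   1 exactly at [j = d]. *)
move=> Fs Fd; pose z0 i := 0 * z i.
have E : map_poly (mmap RC z0) (muni F) = mmap RC z (muni F)`_d *: 'X^d.
  apply/polyP => j; rewrite coefZ coefXn coef_map /=.
  case: (ltngtP j d) => [jd|dj|->].
  - rewrite (mmap_dhomog _ _ _ (dhomog_coef_muni j Fd)) expr0n.
    by rewrite subn_eq0 leqNgt jd mul0r mulr0.
  - by rewrite (coef_muni_gt Fd dj) mmap0 mulr0.
  - rewrite (mmap_dhomog _ _ _ (dhomog_coef_muni d Fd)) subnn expr0.
    by rewrite mul1r mulr1.
have : mmap RC (extend z0 1) F != 0.
  apply: Fs; last by exists ord_max; rewrite extend_max ltr01.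
  by apply: (extend_all (P := fun y => 0 <= Re y)) => [i|];
    rewrite /z0 ?mul0r //= ler01.
by rewrite -horner_muni E hornerZ hornerXn expr1n mulr1.
Qed.

(** A coordinate of [z] strictly inside lets the last variable range over the whole closed
    half-plane; the degree in it is full, so the coefficients up to [d] are nonzero. *)
Lemma strongly_stable_slice m d n (F : {mpoly R[m.+1]}) :
  strongly_stable F -> F \is d.-homog -> (n <= d)%N ->
  strongly_stable (muni F)`_n.
Proof.
move=> Fs Fd nd z z0 [i zi].
rewrite -(coef_map (mmap RC z)) /=; apply: coef_neq0_half_plane.
  move=> t t0; rewrite horner_muni; apply: Fs.
    exact: (extend_all (P := fun y => 0 <= Re y)).
  by exists (widen_ord (leqnSn m) i); rewrite extend_widen.
apply: (leq_ltn_trans nd); rewrite ltnNge.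
apply: contra (strongly_stable_lead z Fs Fd) => /leq_sizeP/(_ _ (leqnn d)) h.
by rewrite -(coef_map (mmap RC z)) /= h.
Qed.

(* If t <> 0 is not a negative real, multiplying by |t| + conj t brings both t and
   the positive reals into the right half-plane. *)
Lemma strongly_stable_roots m d (F : {mpoly R[m.+2]}) (x : 'I_m.+1 -> R) t :
  strongly_stable F -> F \is d.-homog -> (forall i, 0 < x i) ->
  mmap RC (extend (fun i => RC (x i)) t) F = 0 ->
  (complex.Im t == 0) && (Re t < 0).
Proof.
move=> Fs Fd x0 F0; apply/negPn/negP => tn.
have [t0|t0] := eqVneq t 0.
  suff : mmap RC (extend (fun i => RC (x i)) t) F != 0 by rewrite F0 eqxx.
  apply: Fs.
    apply: (extend_all (P := fun y => 0 <= Re y)) => [i|]; first by rewrite /= ltW.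
    by rewrite t0 lexx.
  by exists (widen_ord (leqnSn _) ord0); rewrite extend_widen /= x0.
pose N := Num.sqrt (Re t ^+ 2 + complex.Im t ^+ 2).
have N0 : 0 <= N by apply: sqrtr_ge0.
have N2 : N ^+ 2 = Re t ^+ 2 + complex.Im t ^+ 2.
  by rewrite sqr_sqrtr // addr_ge0 ?sqr_ge0.
have Np : 0 < N.
  rewrite lt_neqAle N0 andbT eq_sym; apply: contraNneq t0 => N00.
  move: N2; rewrite N00 expr0n /= => /esym/eqP; rewrite paddr_eq0 ?sqr_ge0 //.
  by rewrite !sqrf_eq0 eq_complex.
have ltN : 0 < N + Re t.
  have [tn0|tp] := ltP (Re t) 0; last by rewrite ltr_wpDr.
  have im2 : 0 < complex.Im t ^+ 2.
    by rewrite lt_neqAle sqr_ge0 andbT eq_sym sqrf_eq0; move: tn; rewrite tn0 andbT.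
  rewrite ltNge; apply/negP => le; move: N2 => /eqP; rewrite lt_eqF //.
  nra.
pose a : R[i] := Complex (N + Re t) (- complex.Im t).
have at0 : Re (a * t) = N * (N + Re t).
  rewrite mulrDr -expr2 N2 /a; clearbody N.
  by clear; case: t => b c /=; ring.
have : mmap RC (fun i => a * extend (fun i => RC (x i)) t i) F != 0.
  apply: Fs.
    apply: (extend_all (P := fun y => 0 <= Re (a * y))) => [i|].
      by rewrite /a /= mulr0 subr0 mulr_ge0 // ltW.
    by rewrite at0 mulr_ge0 // ltW.
  by exists ord_max; rewrite extend_max at0 mulr_gt0.
by rewrite (mmap_dhomog _ _ _ Fd) F0 mulr0 eqxx.
Qed.

Lemma strongly_stable_factor m d (F : {mpoly R[m.+2]}) (x : 'I_m.+1 -> R) :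
  strongly_stable F -> F \is d.-homog -> (forall i, 0 < x i) ->
  exists c, exists2 s, all (> 0) s & [/\ c != 0, size s = d &
    map_poly (meval x) (muni F) = c *: \prod_(w <- s) ('X + w%:P)].
Proof.
move=> Fs Fd x0; set f := map_poly _ _.
have fd0 : f`_d != 0.
  have := strongly_stable_lead (fun i => RC (x i)) Fs Fd.
  by rewrite mmap_real fmorph_eq0 /f coef_map.
have f0 : f != 0 by apply: contraNneq fd0 => ->; rewrite coef0.
have sf : size f = d.+1.
  apply/eqP; rewrite eqn_leq; apply/andP; split.
    by apply/leq_sizeP => j dj; rewrite coef_map /= (coef_muni_gt Fd dj) raddf0.
  by rewrite ltnNge; apply: contra fd0 => /leq_sizeP/(_ _ (leqnn d))->.
have [|s s0 fE] := negative_roots_factor f0.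
  move=> z /rootP fz; apply: (strongly_stable_roots Fs Fd x0).
  rewrite -horner_muni -fz -map_poly_comp; congr (_.[_]); apply: eq_map_poly => P.
  by rewrite mmap_real.
have lf : lead_coef f != 0 by rewrite lead_coef_eq0.
exists (lead_coef f), s => //; split => //.
apply: succn_inj; rewrite -sf fE size_scale //.
rewrite (eq_bigr (fun w => 'X - (- w)%:P)) => [|w _]; last by rewrite polyCN opprK.
by rewrite size_prod_XsubC.
Qed.

Lemma vdw_gt0 n : 0 < vdw R n.
Proof.
rewrite /vdw divr_gt0 ?ltr0n ?fact_gt0 //; case: n => [|n]; first exact: ltr01.
by rewrite exprn_gt0 ?ltr0n.
Qed.

Lemma vdw_bin k n : (n <= k)%N ->
  n%:R ^+ n * (k - n)%:R ^+ (k - n) / k%:R ^+ k *+ 'C(k, n) =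
  vdw R k / (vdw R n * vdw R (k - n)).
Proof.
move=> nk; rewrite /vdw -(bin_fact nk) !natrM -mulr_natr.
have ne j : j%:R ^+ j != 0 :> R.
  by case: j => [|j]; rewrite ?expr0 ?oner_eq0 // expf_neq0 // pnatr_eq0.
have fe j : j`!%:R != 0 :> R by rewrite pnatr_eq0 -lt0n fact_gt0.
by field; rewrite !ne !fe.
Qed.

Lemma strongly_stable_slice_ge m d n (F : {mpoly R[m.+2]}) (x : 'I_m.+1 -> R)
    (C : R) :
  strongly_stable F -> F \is d.-homog -> (0 < n < d)%N -> (forall i, 0 < x i) ->
  0 < C -> (forall t, 0 < t -> C * t ^+ n <= F.@[extend x t]) ->
  C * (vdw R d / (vdw R n * vdw R (d - n))) <= ((muni F)`_n).@[x].
Proof.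
move=> Fs Fd nd x0 C0 H.
have [c [s s0 [c0 sd fE]]] := strongly_stable_factor Fs Fd x0.
have fH t : F.@[extend x t] = c * (\prod_(w <- s) ('X + w%:P)).[t].
  by rewrite -hornerZ -fE /meval horner_muni.
(* So far only [c != 0] is known; the sign comes from the lower bound at [t = 1]. *)
have cp : 0 < c.
  have := H 1 ltr01; rewrite fH expr1n mulr1 => /(lt_le_trans C0).
  rewrite pmulr_lgt0 // horner_prod big_seq prodr_gt0 // => w /(allP s0) w0.
  by rewrite !hornerE addr_gt0.
have -> : ((muni F)`_n).@[x] = c * (\prod_(w <- s) ('X + w%:P))`_n.
  by rewrite -coefZ -fE coef_map.
rewrite -vdw_bin; last by case/andP: nd => _ /ltnW.
rewrite -ler_pdivrMl // mulrA mulrnAr -sd; apply: prod_linear_coef_ge => //.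
  by rewrite sd.
by move=> t t0; rewrite -mulrA ler_pdivrMl // -fH H.
Qed.

Lemma mpoly_unique_monomial m (F : {mpoly R[m]}) r0 :
  (forall r, r \in msupp F -> r = r0) -> F.@[fun=> 1] = F@_r0.
Proof.
move=> h; have -> : F = F@_r0 *: 'X_[r0].
  apply/mpolyP => r; rewrite mcoeffZ mcoeffX; case: eqP => [->|rr].
    by rewrite mulr1.
  rewrite mulr0; apply/eqP; rewrite mcoeff_eq0; apply/negP => /h E.
  by case: rr.
rewrite mevalZ mevalX mcoeffZ mcoeffX eqxx big1 ?mulr1 // => i _.
by rewrite expr1n.
Qed.

Lemma strongly_stable_mcoeff_ge m n (F : {mpoly R[m]}) (C : R) :
  strongly_stable F -> F \is (n * m).-homog -> 0 < C ->
  (forall x, (forall i, 0 < x i) -> C * \prod_i x i ^+ n <= F.@[x]) ->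
  C * (vdw R (n * m) / vdw R n ^+ m) <= F@_[multinom n | i < m].
Proof.
have H1 k (G : {mpoly R[k]}) D :
    (forall x, (forall i, 0 < x i) -> D * \prod_i x i ^+ n <= G.@[x]) ->
    D <= G.@[fun=> 1].
  move=> /(_ (fun=> 1)); rewrite big1 ?mulr1; last by move=> *; rewrite expr1n.
  by apply => *; exact: ltr01.
(* For [n = 0], as for [m = 0] below, the vdw factor is 1, only one monomial is possible, and the
   bound at the all-ones point is the claim. *)
have [n0|n0] := eqVneq n 0%N.
  rewrite n0 in H1 *; move=> _; rewrite mul0n => /dhomogP Fd C0 /H1 h.
  have -> : vdw R 0 = 1 by rewrite /vdw expr0 divr1.
  rewrite expr1n divr1 mulr1 -mpoly_unique_monomial // => r rF.
  have /eqP : mdeg r = 0%N := Fd _ rF; rewrite mdeg_eq0 => /eqP ->.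
  by apply/mnmP => i; rewrite !mnmE.
case: m F C => [|m] F C.
  rewrite muln0 expr0 divr1 => _ /dhomogP Fd C0 /H1 h.
  have -> : vdw R 0 = 1 by rewrite /vdw expr0 divr1.
  rewrite mulr1 -mpoly_unique_monomial // => r rF.
  by apply/mnmP => -[].
elim: m F C => [|m IH] F C Fs Fd C0 HF.
  rewrite muln1 expr1 divff ?mulr1 ?gt_eqF ?vdw_gt0 //.
  rewrite -mpoly_unique_monomial ?H1 // => r rF; apply/mnmP => i; rewrite mnmE.
  have : mdeg r = (n * 1)%N by move/dhomogP: Fd; apply.
  by rewrite muln1 mdegE big_ord1 => <-; rewrite (ord1 i).
have nd : (n * m.+2 - n = n * m.+1)%N by rewrite [(n * m.+2)%N]mulnS addnC addnK.
have nlt : (0 < n < n * m.+2)%N.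
  by rewrite lt0n n0 /= -[X in (X < _)%N]muln1 ltn_mul2l lt0n n0.
have nle : (n <= n * m.+2)%N by case/andP: nlt => _ /ltnW.
have vn := lt0r_neq0 (vdw_gt0 n); have vm := lt0r_neq0 (vdw_gt0 (n * m.+1)).
rewrite -mcoeff_muni_const.
(* The slice inherits the bound with [C] scaled by the loss factor of the eliminated variable;
   [vdw R (n * m.+1)] then cancels. *)
have := IH (muni F)`_n (C * (vdw R (n * m.+2) / (vdw R n * vdw R (n * m.+1)))).
have -> : C * (vdw R (n * m.+2) / (vdw R n * vdw R (n * m.+1))) *
  (vdw R (n * m.+1) / vdw R n ^+ m.+1) = C * (vdw R (n * m.+2) / vdw R n ^+ m.+2).
  by rewrite [vdw R n ^+ m.+2]exprS; field; rewrite vn vm expf_neq0.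
apply.
- exact: strongly_stable_slice Fs Fd nle.
- by rewrite -nd; apply: dhomog_coef_muni.
- exact: mulr_gt0 C0 (divr_gt0 (vdw_gt0 _) (mulr_gt0 (vdw_gt0 _) (vdw_gt0 _))).
move=> x x0; rewrite mulrAC -nd; apply: strongly_stable_slice_ge => //.
  by rewrite mulr_gt0 // prodr_gt0 // => i _; rewrite exprn_gt0.
move=> t t0; have := HF (extend x t); rewrite big_ord_recr /= extend_max mulrA.
under eq_bigr do rewrite extend_widen.
by apply; apply: (extend_all (P := fun y => 0 < y)).
Qed.

End Stable.

(** * Perturbation and coefficient reversal *)

Lemma meval_map_mpoly (R S : comNzRingType) (k : nat) (f : {rmorphism R -> S})
    (z : 'I_k -> S) (F : {mpoly R[k]}) : (map_mpoly f F).@[z] = mmap f z F.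
Proof.
rewrite [map_mpoly f F]/mmap raddf_sum; apply: eq_bigr => r _ /=.
by rewrite mevalM mevalC mmap1_id mevalX.
Qed.

Section Perturb.
Variables (R : realType) (m : nat).
Local Notation Re := complex.Re.
Local Notation RC := (real_complex R).
Implicit Types F : {mpoly R[m]}.

Definition perturb (e : R) F : {mpoly R[m]} :=
  F \mPo [tuple 'X_i + e *: \sum_j 'X_j | i < m].

Lemma mmap_perturb (S : comNzRingType) (f : {rmorphism R -> S}) (z : 'I_m -> S) e F :
  mmap f z (perturb e F) = mmap f (fun i => z i + f e * \sum_j z j) F.
Proof.
rewrite /perturb comp_mpolyEX raddf_sum; apply: eq_bigr => r _ /=.
rewrite mmapZ comp_mpolyX rmorph_prod; congr (_ * _); apply: eq_bigr => i _.
rewrite rmorphXn tnth_mktuple rmorphD /= mmapX mmap1U mmapZ raddf_sum /=.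
congr ((_ + _ * _) ^+ _); apply: eq_bigr => j _.
by rewrite mmapX mmap1U.
Qed.

Lemma dhomog_perturb d e F : F \is d.-homog -> perturb e F \is d.-homog.
Proof.
move=> /dhomogP Fd; rewrite /perturb comp_mpolyEX big_seq; apply: rpred_sum => r rF.
have rd : mdeg r = d := Fd _ rF; apply: dhomogZ.
rewrite comp_mpolyX -rd mdegE.
apply: (big_ind2 (fun (P : {mpoly R[m]}) k => P \is k.-homog)) => [|P k Q j|i _].
- exact: dhomog1.
- exact: dhomogM.
rewrite tnth_mktuple -[X in X.-homog]mul1n; apply: dhomogMn; apply: dhomogD.
  by rewrite dhomogX [X in X == _]mdeg1.
by apply: dhomogZ; apply: rpred_sum => j _; rewrite dhomogX [X in X == _]mdeg1.
Qed.

(** Taking [e] as the indeterminate of the coefficient ring [{poly R}] gives one polynomial [G] that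
    specialises to every perturbation, which permits the limit at 0. *)
Lemma mcoeff_perturb_poly F r0 :
  exists g : {poly R}, forall e, (perturb e F)@_r0 = g.[e].
Proof.
pose G : {mpoly {poly R}[m]} := \sum_(r <- msupp F) (F@_r)%:P *:
  \prod_(i < m) ('X_i + 'X *: \sum_j 'X_j) ^+ r i.
exists G@_r0 => e.
have evalE (P : {poly R}) : horner_eval e P = P.[e] by [].
rewrite -[RHS]/(horner_eval e _) -mcoeff_map_mpoly.
congr (_@__); rewrite /perturb comp_mpolyEX [RHS]raddf_sum; apply: eq_bigr => r _ /=.
rewrite map_mpolyZ /= evalE hornerC comp_mpolyX rmorph_prod; congr (_ *: _).
apply: eq_bigr => i _; rewrite tnth_mktuple rmorphXn rmorphD /= map_mpolyX.
rewrite map_mpolyZ /= evalE hornerX [map_mpoly _ (\sum_j _)]raddf_sum /=.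
by congr ((_ + _ *: _) ^+ _); apply: eq_bigr => j _; rewrite map_mpolyX.
Qed.

Lemma perturb0 F : perturb 0 F = F.
Proof.
rewrite -[RHS]comp_mpoly_id /perturb; congr (_ \mPo _).
by apply: eq_from_tnth => i; rewrite !tnth_mktuple scale0r addr0.
Qed.

Lemma horner_right_limit (g : {poly R}) (a : R) :
  (forall e : R, 0 < e -> a <= g.[e]) -> a <= g.[0].
Proof.
move=> h; rewrite leNgt; apply/negP => lt.
have [q qE] : exists q : {poly R}, g = q * 'X + (g.[0])%:P.
  elim/poly_ind: g {h lt} => [|q c _]; first by exists 0; rewrite horner0 mul0r add0r.
  by exists q; rewrite !hornerE ?mulr0 ?add0r.
have [M HM] := poly_itv_bound q 0 1.
pose d := a - g.[0]; have d0 : 0 < d by rewrite subr_gt0.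
have M0 : 0 <= M by apply: le_trans (normr_ge0 q.[0]) (HM 0 _); rewrite lexx ler01.
(* Chosen so that [e <= 1] and [M * e < d]. *)
pose e := d / (d + M + 1).
have D0 : 0 < d + M + 1 by rewrite -addrA ltr_wpDr // addr_ge0.
have e0 : 0 < e by rewrite divr_gt0.
have e1 : e <= 1 by rewrite ler_pdivrMr // mul1r -addrA lerDl addr_ge0.
have := h e e0; rewrite {1}qE hornerD hornerMX hornerC.
have : q.[e] * e < d.
  have qM : q.[e] <= M by apply: le_trans (ler_norm _) (HM e _); rewrite ltW.
  apply: le_lt_trans (ler_wpM2r (ltW e0) qM) _.
  rewrite /e mulrA ltr_pdivrMr // mulrC ltr_pM2l //; lra.
by rewrite -lerBlDr => h1 /(lt_le_trans h1); rewrite ltxx.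
Qed.

Lemma meval_ge0_mono F (x y : 'I_m -> R) : (forall r, 0 <= F@_r) ->
  (forall i, 0 <= x i <= y i) -> 0 <= F.@[x] <= F.@[y].
Proof.
move=> F0 xy; rewrite !mevalE; apply/andP; split.
  apply: sumr_ge0 => r _; rewrite mulr_ge0 // prodr_ge0 // => i _.
  by rewrite exprn_ge0 //; case/andP: (xy i).
apply: ler_sum => r _; apply: ler_wpM2l => //; apply: ler_prod => i _.
by case/andP: (xy i) => x0 xyi; rewrite exprn_ge0 // lerXn2r // nnegrE (le_trans x0).
Qed.

(** One coordinate strictly inside makes the real part of the sum positive, so the substitution
    pushes every coordinate into the open half-plane. *)
Lemma strongly_stable_perturb e F : 0 < e -> HStable F ->
  strongly_stable (perturb e F).
Proof.
move=> e0 Fs z z0 [i zi]; rewrite mmap_perturb.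
have := Fs (fun i => z i + RC e * \sum_j z j).
rewrite meval_map_mpoly; apply => j.
have ReM (a : R) w : Re (RC a * w) = a * Re w by case: w => b c /=; rewrite mul0r subr0.
have ReS : Re (\sum_j z j) = \sum_j Re (z j).
  by elim/big_ind2: _ => // [x1 x2 y1 y2 <- <-]; rewrite complex_ReD.
rewrite complex_ReD ReM ReS ltr_wpDl // mulr_gt0 //.
by rewrite (bigD1 i) //= ltr_wpDr // sumr_ge0.
Qed.

End Perturb.

Section Reverse.
Variables (R : realType) (m n : nat).
Local Notation Re := complex.Re.
Local Notation RC := (real_complex R).
Implicit Types (p q : {mpoly R[m]}).

(** For [n]-homogeneous [q] this is [(x_1 ... x_m)^n q(1/x_1, ..., 1/x_m)]: exponents are then at
    most [n], so the truncated subtraction is exact. *)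
Definition mreverse q : {mpoly R[m]} :=
  \sum_(r <- msupp q) q@_r *: 'X_[[multinom (n - r i)%N | i < m]].

Lemma dhomog_exp_le q r i : q \is n.-homog -> r \in msupp q -> (r i <= n)%N.
Proof.
move=> /dhomogP qn /qn rn; have {rn} <- : mdeg r = n := rn.
by rewrite mdegE (bigD1 i) //= leq_addr.
Qed.

Lemma mmap_mreverse (S : fieldType) (f : {rmorphism R -> S}) (z : 'I_m -> S) q :
  q \is n.-homog -> (forall i, z i != 0) ->
  mmap f z (mreverse q) = \prod_i z i ^+ n * mmap f (fun i => (z i)^-1) q.
Proof.
move=> qn z0; rewrite raddf_sum [in RHS]/mmap mulr_sumr; apply: eq_big_seq => r rq /=.
rewrite mmapZ mmapX mulrCA /mmap1 -big_split; congr (_ * _).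
apply: eq_bigr => i _ /=; rewrite mnmE exprVn expfB_cond //.
by rewrite (negbTE (z0 i)) (dhomog_exp_le i qn rq).
Qed.

Lemma dhomog_mreverse q : q \is n.-homog -> mreverse q \is (n * m - n).-homog.
Proof.
move=> qn; rewrite /mreverse big_seq; apply: rpred_sum => r rq.
apply: dhomogZ; rewrite dhomogX; apply/eqP; rewrite [LHS]mdegE.
under eq_bigr do rewrite mnmE.
rewrite sumnB; last by move=> i _; apply: dhomog_exp_le qn rq.
rewrite sum_nat_const card_ord mulnC; congr (_ - _)%N.
by move/dhomogP: qn => /(_ r rq) <-; rewrite [RHS]mdegE.
Qed.

Lemma mreverse_ge0 q r : (forall s, 0 <= q@_s) -> 0 <= (mreverse q)@_r.
Proof.
move=> q0; rewrite raddf_sum; apply: sumr_ge0 => s _ /=.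
by rewrite mcoeffZ mulr_ge0 // mcoeffX ler0n.
Qed.

(** A monomial of [q] with exponent [r] is reversed to [n - r], which only the exponent [r] of [p]
    completes to the constant exponent [n]. *)
Lemma mcoeff_mul_mreverse p q : q \is n.-homog ->
  (p * mreverse q)@_[multinom n | i < m] =
  \sum_(r : 'X_{1..m < n.+1} | mdeg r == n) p@_r * q@_r.
Proof.
move=> qn; rewrite /mreverse mulr_sumr raddf_sum /=.
transitivity (\sum_(r <- msupp q) p@_r * q@_r).
  apply: eq_big_seq => r rq; rewrite -scalerAr mcoeffZ mulrC; congr (_ * _).
  have -> : [multinom n | i < m] = ([multinom (n - r i)%N | i < m] + r)%MM.
    by apply/mnmP => i; rewrite mnmDE !mnmE subnK // (dhomog_exp_le i qn rq).
  by rewrite mcoeffMX.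
have qd r : r \in msupp q -> mdeg r = n by move/dhomogP: qn; apply.
pose I : subFinType _ := 'X_{1..m < n.+1}.
rewrite (ssrcomplements.big_mksub I) /=; first last.
  by move=> r /qd ->.
  by rewrite msupp_uniq.
rewrite big_mkcond [RHS]big_mkcond; apply: eq_bigr => r _ /=.
case: ifPn => [/qd ->|rq]; first by rewrite eqxx.
by rewrite (memN_msupp_eq0 rq) mulr0 if_same.
Qed.

End Reverse.

(** * Capacity bound, stability of the product and the final inequality *)

Lemma capacity_le (R : realType) m (l : 'I_m -> R) (p : {mpoly R[m]}) x :
  (forall r, 0 <= p@_r) -> (forall i, 0 < x i) ->
  capacity l p * \prod_i x i `^ l i <= p.@[x].
Proof.
move=> p0 x0; have xl y : (forall i, 0 < y i) -> 0 < \prod_i y i `^ l i.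
  by move=> y0; rewrite prodr_gt0 // => i _; rewrite powR_gt0.
rewrite -ler_pdivlMr ?xl //; apply: ge_inf; last by exists x.
exists 0 => _ [y y0 <-]; rewrite divr_ge0 ?(ltW (xl _ _)) //.
suff /andP[] : 0 <= p.@[y] <= p.@[y] by [].
by apply: meval_ge0_mono => // i; rewrite lexx ltW // y0.
Qed.

(** Inversion maps the open right half-plane to itself, and the monomial prefactor of the reversal
    does not vanish there. *)
Lemma HStable_mul_mreverse (R : realType) m n (p q : {mpoly R[m]}) :
  q \is n.-homog -> HStable p -> HStable q -> HStable (p * mreverse n q).
Proof.
move=> qn ps qs z z0.
have zn i : z i != 0 by apply: contraTneq (z0 i) => ->; rewrite ltxx.
rewrite [map_mpoly _ _]rmorphM mevalM.
apply: mulf_neq0; first exact: ps.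
rewrite meval_map_mpoly mmap_mreverse // mulf_neq0 //.
  by rewrite prodf_seq_neq0; apply/allP => i _; rewrite expf_neq0.
rewrite -meval_map_mpoly qs // => i; exact: complex_ReV_gt0.
Qed.

Theorem theorem3p9 (R : realType) (m n : nat) (p q : {mpoly R[m]})
    (l : 'I_m -> R)
    (p_homog : p \is n.-homog) (q_homog : q \is n.-homog)
    (p_coef_ge0 : forall r : 'X_{1..m}, 0 <= p@_r)
    (q_coef_ge0 : forall r : 'X_{1..m}, 0 <= q@_r)
    (p_stable : HStable p) (q_stable : HStable q)
    (l_ge0 : forall i, 0 <= l i) (l_sum : \sum_(i < m) l i = n%:R)
    (A_gt0 : 0 < capacity l p) (B_gt0 : 0 < capacity l q) :
  capacity l p * capacity l q * (vdw R (n * m) / vdw R n ^+ m)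
    <= \sum_(r : 'X_{1..m < n.+1} | mdeg r == n) p@_r * q@_r.
Proof.
rewrite -mcoeff_mul_mreverse //; set F := p * mreverse n q.
(* Without variables [l_sum] forces [n = 0]; hence the subtraction in the degree of [mreverse n q]
   is exact. *)
have nm : (n <= n * m)%N.
  case: m l l_sum {F p q p_homog q_homog p_coef_ge0 q_coef_ge0 p_stable q_stable
    A_gt0 B_gt0 l_ge0} => [|m] l l_sum; last by rewrite leq_pmulr.
  by move/eqP: l_sum; rewrite big_ord0 eq_sym pnatr_eq0 => /eqP ->.
have Fd : F \is (n * m).-homog.
  by rewrite -(subnKC nm); apply: dhomogM => //; apply: dhomog_mreverse.
have Fs : HStable F by apply: HStable_mul_mreverse.
have Fcap (x : 'I_m -> R) : (forall i, 0 < x i) ->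
    capacity l p * capacity l q * \prod_i x i ^+ n <= F.@[x].
  move=> x0; have xn i : x i != 0 by rewrite gt_eqF.
  have Eq : (mreverse n q).@[x] = \prod_i x i ^+ n * q.@[fun i => (x i)^-1].
    exact: (mmap_mreverse idfun q_homog xn).
  have xl : 0 < \prod_i x i `^ l i.
    by rewrite prodr_gt0 // => i _; rewrite powR_gt0.
  have xp : 0 < \prod_i x i ^+ n by rewrite prodr_gt0 // => i _; rewrite exprn_gt0.
  have hp := capacity_le l p_coef_ge0 x0.
  (* At the inverted point the exponents [l] change sign, and they cancel those in the bound for
     [p]. *)
  have hq : capacity l q / \prod_i x i `^ l i <= q.@[fun i => (x i)^-1].
    have := @capacity_le _ _ l q (fun i => (x i)^-1) q_coef_ge0.
    rewrite -prodfV;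
    under [in X in (_ -> X) -> _]eq_bigr do
      rewrite -powR_inv1 ?ltW // -powRrM mulN1r powRN.
    by apply => i; rewrite invr_gt0.
  rewrite mevalM Eq mulrCA [leRHS]mulrC; apply: ler_wpM2r; first exact: ltW.
  apply: le_trans (ler_pM _ _ hp hq).
  - by rewrite mulrACA divff ?mulr1 // gt_eqF.
  - by rewrite mulr_ge0 // ltW.
  - by rewrite divr_ge0 // ltW.
(* The coefficient is polynomial in [e], so bounding it for all positive [e] suffices. *)
have [g gE] := mcoeff_perturb_poly F [multinom n | i < m].
rewrite -(perturb0 F) gE; apply: horner_right_limit => e e0; rewrite -gE.
apply: strongly_stable_mcoeff_ge.
- exact: strongly_stable_perturb.
- exact: dhomog_perturb.
- exact: mulr_gt0.
(* The perturbation enlarges each coordinate of a positive point, and both factors of [F] have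
   nonnegative coefficients, so the bound persists. *)
move=> x x0; apply: le_trans (Fcap x x0) _.
rewrite [leRHS](mmap_perturb idfun) -/(meval _ _) !mevalM.
pose y i := x i + e * \sum_j x j.
have xy i : 0 <= x i <= y i.
  rewrite (ltW (x0 i)) lerDl mulr_ge0 ?(ltW e0) //.
  by apply: sumr_ge0 => j _; apply: ltW.
have /andP[p1 p2] := meval_ge0_mono p_coef_ge0 xy.
have /andP[q1 q2] := meval_ge0_mono (fun r => mreverse_ge0 n r q_coef_ge0) xy.
exact: ler_pM.
Qed.
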